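(* Let $t_0,y_0 \in \mathbb{R}$, $a>0$, $I=[t_0,t_0+a]$, and let $f:I\times \mathbb{R} \to \mathbb{R}$ be continuous. Suppose that the problem $$y'=f(t,y) \quad \text{for all } t \in I, \qquad y(t_0)=y_0,$$ has a lower solution $\alpha$ and an upper solution $\beta$ such that $\alpha(t) \le \beta(t)$ for all $t \in I$. Then this problem has at least one solution $\varphi:I \to \mathbb{R}$ such that $$\alpha(t) \le \varphi(t) \le \beta(t) \quad \text{for all } t \in I.$$
   Context: An upper solution of the problem is a function $\beta:I \to \mathbb{R}$ which is continuously differentiable in $I$, with $\beta(t_0) \ge y_0$ and $\beta'(t) \ge f(t,\beta(t))$ for all $t \in I$. A lower solution is a function $\alpha:I \to \mathbb{R}$ which is continuously differentiable in $I$, with $\alpha(t_0) \le y_0$ and $\alpha'(t) \le f(t,\alpha(t))$ for all $t \in I$. A solution on $I$ is a differentiable function $\varphi:I\to\mathbb{R}$ with $\varphi(t_0)=y_0$ and $\varphi'(t)=f(t,\varphi(t))$ for all $t\in I$. Derivatives at the endpoints of $I$ are one-sided. *)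

(* Defs.v *)
From Stdlib Require Import Reals.
From Coquelicot Require Import Coquelicot.
Open Scope R_scope.

(* Functions on I = [t0, t0 + a] are represented by total functions on R; every
   condition below only involves their values on I. *)
Definition I_set (t0 a : R) : R -> Prop := fun t => t0 <= t <= t0 + a.

Definition continuous_on_strip (t0 a : R) (f : R -> R -> R) : Prop :=
  continuous_on (fun p : R * R => I_set t0 a (fst p))
                (fun p : R * R => f (fst p) (snd p)).

(* [D_in y dy D t] is the derivative at [t] relative to the domain [D]: for
   D = I it is two-sided in the interior and one-sided at the endpoints. *)
Definition has_derivative_on (D : R -> Prop) (y dy : R -> R) : Prop :=
  forall t, D t -> D_in y dy D t.

Definition solution (f : R -> R -> R) (t0 y0 a : R) (phi : R -> R) : Prop :=
  phi t0 = y0 /\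
  has_derivative_on (I_set t0 a) phi (fun t => f t (phi t)).

Definition upper_solution (f : R -> R -> R) (t0 y0 a : R) (beta : R -> R) : Prop :=
  exists dbeta : R -> R,
    has_derivative_on (I_set t0 a) beta dbeta /\
    continuous_on (I_set t0 a) dbeta /\
    beta t0 >= y0 /\
    (forall t, I_set t0 a t -> dbeta t >= f t (beta t)).

Definition lower_solution (f : R -> R -> R) (t0 y0 a : R) (alpha : R -> R) : Prop :=
  exists dalpha : R -> R,
    has_derivative_on (I_set t0 a) alpha dalpha /\
    continuous_on (I_set t0 a) dalpha /\
    alpha t0 <= y0 /\
    (forall t, I_set t0 a t -> dalpha t <= f t (alpha t)).

(* Main.v *)
(* Truncate f to F t x = f t (max (alpha t) (min (beta t) x)), which is continuous and
   bounded on the strip. The Euler step functions of y' = F t y with mesh h are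
   Lipschitz up to an error O(h), and their increments are within eps of the linear
   ones wherever F varies by at most eps. Such estimates involve finitely many times
   only, so they pass to a pointwise limit along an ultrafilter, which therefore
   solves y' = F t y. Where a solution phi exceeds beta one has F t phi = f t beta <=
   beta', so phi - beta cannot become positive; alpha is symmetric, and between the
   two F agrees with f. *)
Require Import Defs.
From mathcomp Require filter ssrnat.
From Stdlib Require Import Reals Lra Lia ClassicalEpsilon List.
From Coquelicot Require Import Coquelicot.
Open Scope R_scope.

(** * Ultrafilter limits and compactness *)

(** The ultrafilter lemma is applied to the filter of eventually true predicates; containing that
    filter is what makes [U] free. *)
Lemma free_ultrafilter_on_nat :
  exists U : (nat -> Prop) -> Prop,
    (forall P Q : nat -> Prop, (forall n, P n -> Q n) -> U P -> U Q) /\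
    (forall P Q, U P -> U Q -> U (fun n => P n /\ Q n)) /\
    (forall P, U P -> exists n, P n) /\
    (forall N, U (fun n => (N <= n)%nat)) /\
    (forall P, U P \/ U (fun n => ~ P n)).
Proof.
  destruct (filter.ultraFilterLemma filter.eventually_filter) as [U [HU Hsub]].
  pose proof (@filter.ultra_proper _ _ HU) as HP.
  pose proof (@filter.filter_filter _ _ HP) as HF.
  exists U; repeat split.
  - exact (@filter.filterS _ _ HF).
  - exact (@filter.filterI _ _ HF).
  - intros P hP; apply NNPP; intros hno.
    apply (@filter.filter_not_empty _ _ HP).
    refine (@filter.filterS _ _ HF _ _ _ hP).
    intros n hn; apply hno; exists n; exact hn.
  - intros N; apply Hsub; exists N; [exact I |].
    intros n hn; exact (ssrbool.elimT ssrnat.leP hn).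
  - intros P; exact (filter.in_ultra_setVsetC P HU).
Qed.

(* Sequential compactness of a product of intervals, without extracting a
   subsequence: [l] is the pointwise limit along a free ultrafilter. *)
Lemma pointwise_cluster_point (T : Type) (u : nat -> T -> R) :
  exists l : T -> R, forall (eta : R) (N : nat) (xs : list T), 0 < eta ->
    (forall x, In x xs -> exists B, forall n, Rabs (u n x) <= B) ->
    exists n, (N <= n)%nat /\ forall x, In x xs -> Rabs (u n x - l x) < eta.
Proof.
  destruct free_ultrafilter_on_nat as [U [US [UI [Une [Uge Uor]]]]].
  assert (Hlim : forall x, exists l, (exists B, forall n, Rabs (u n x) <= B) ->
    forall eta, 0 < eta -> U (fun n => Rabs (u n x - l) < eta)).
  { intros x.
    destruct (classic (exists B, forall n, Rabs (u n x) <= B)) as [[B hB] | hno];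
      [| exists 0; intros h; contradiction].
    (* The limit along [U] is the supremum of the levels that [u n x] reaches for [U]-almost all
       [n]. Levels slightly below it are reached on a set of [U]; levels above it are not, so by the
       ultra property the complement lies in [U]. *)
    destruct (completeness (fun r => U (fun n => r <= u n x))) as [l [hub hlub]].
    - exists B; intros r hr.
      destruct (Une _ hr) as [n hn]; specialize (hB n).
      pose proof (Rle_abs (u n x)); lra.
    - exists (- B); apply (US (fun n => (0 <= n)%nat)); [| apply Uge].
      intros n _; specialize (hB n).
      pose proof (Rle_abs (- u n x)) as h; rewrite Rabs_Ropp in h; lra.
    - exists l; intros _ eta heta.
      assert (h1 : U (fun n => l - eta / 2 <= u n x)).
      { apply NNPP; intros hn.
        assert (l <= l - eta / 2); [| lra].
        apply hlub; intros r hr.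
        destruct (Rle_lt_dec r (l - eta / 2)) as [h | h]; [exact h |].
        exfalso; apply hn; apply (US (fun n => r <= u n x)); [intros; lra | exact hr]. }
      assert (h2 : U (fun n => ~ (l + eta / 2 <= u n x))).
      { destruct (Uor (fun n => l + eta / 2 <= u n x)) as [h | h]; [| exact h].
        specialize (hub _ h); simpl in hub; lra. }
      apply (US (fun n => l - eta / 2 <= u n x /\ ~ (l + eta / 2 <= u n x)));
        [| exact (UI _ _ h1 h2)].
      intros n [h3 h4]; apply Rabs_def1; lra. }
  destruct (choice _ Hlim) as [l hl].
  exists l; intros eta N xs heta hB.
  apply Une; induction xs as [| x xs IH].
  - apply (US (fun n => (N <= n)%nat)); [| apply Uge].
    intros n hn; split; [exact hn | intros x []].
  - apply (US (fun n => Rabs (u n x - l x) < eta /\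
      ((N <= n)%nat /\ forall x, In x xs -> Rabs (u n x - l x) < eta))).
    + intros n [h1 [h2 h3]]; split; [exact h2 |].
      intros y [<- | hy]; [exact h1 | exact (h3 y hy)].
    + apply UI; [apply hl; [apply hB; left; reflexivity | exact heta] |].
      apply IH; intros y hy; apply hB; right; exact hy.
Qed.

(** If no bound existed, points [p n] with values above [n] would have a cluster point. It stays in
    the closed rectangle, and the local bound there fails for large [n]. *)
Lemma bounded_on_rectangle (a b c d : R) (g : R -> R -> R) :
  (forall t x, a <= t <= b -> c <= x <= d -> exists delta K, 0 < delta /\
     forall t' x', a <= t' <= b -> c <= x' <= d ->
       Rabs (t' - t) < delta -> Rabs (x' - x) < delta -> Rabs (g t' x') <= K) ->
  exists K, forall t x, a <= t <= b -> c <= x <= d -> Rabs (g t x) <= K.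
Proof.
  intros hloc; apply NNPP; intros hno.
  assert (hseq : forall n, exists p : R * R,
    a <= fst p <= b /\ c <= snd p <= d /\ INR n < Rabs (g (fst p) (snd p))).
  { intros n; apply NNPP; intros hn; apply hno; exists (INR n).
    intros t x ht hx; destruct (Rle_lt_dec (Rabs (g t x)) (INR n)) as [h | h]; [exact h |].
    exfalso; apply hn; exists (t, x); simpl; auto. }
  destruct (choice _ hseq) as [p hp].
  (* Indexing by [bool] treats the two coordinates as a family, so one [n] serves both. *)
  destruct (pointwise_cluster_point bool
    (fun n i => if i then fst (p n) else snd (p n))) as [l hl].
  assert (hl' : forall eta N, 0 < eta -> exists n, (N <= n)%nat /\
    Rabs (fst (p n) - l true) < eta /\ Rabs (snd (p n) - l false) < eta).
  { intros eta N heta.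
    destruct (hl eta N (true :: false :: nil) heta) as [n [hn h]].
    - intros i _; exists (Rmax (Rmax (- a) b) (Rmax (- c) d)); intros n.
      destruct (hp n) as [h1 [h2 _]].
      pose proof (Rmax_l (Rmax (- a) b) (Rmax (- c) d)).
      pose proof (Rmax_r (Rmax (- a) b) (Rmax (- c) d)).
      pose proof (Rmax_l (- a) b). pose proof (Rmax_r (- a) b).
      pose proof (Rmax_l (- c) d). pose proof (Rmax_r (- c) d).
      destruct i; apply Rabs_le; lra.
    - exists n; split; [exact hn |].
      split; [apply (h true) | apply (h false)]; simpl; auto. }
  assert (hin : a <= l true <= b /\ c <= l false <= d).
  { repeat split; apply Rnot_lt_le; intros hlt;
      [ destruct (hl' (a - l true) O) as [n [_ [h1 h2]]]
      | destruct (hl' (l true - b) O) as [n [_ [h1 h2]]]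
      | destruct (hl' (c - l false) O) as [n [_ [h1 h2]]]
      | destruct (hl' (l false - d) O) as [n [_ [h1 h2]]] ]; try lra;
      apply Rabs_def2 in h1; apply Rabs_def2 in h2; destruct (hp n) as [? [? _]]; lra. }
  destruct hin as [h1 h2].
  destruct (hloc _ _ h1 h2) as [delta [K [hd hK]]].
  destruct (INR_unbounded K) as [N hN].
  destruct (hl' delta N hd) as [n [hn [h3 h4]]].
  destruct (hp n) as [h5 [h6 h7]].
  specialize (hK _ _ h5 h6 h3 h4).
  apply le_INR in hn; lra.
Qed.

(** * Epsilon-delta forms of continuity and differentiability *)

Lemma continuous_on_strip_iff (t0 a : R) (f : R -> R -> R) :
  continuous_on_strip t0 a f <->
  forall t x eps, I_set t0 a t -> 0 < eps -> exists delta, 0 < delta /\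
    forall t' x', I_set t0 a t' -> Rabs (t' - t) < delta -> Rabs (x' - x) < delta ->
      Rabs (f t' x' - f t x) < eps.
Proof.
  split.
  - intros hf t x eps ht heps.
    specialize (hf (t, x) ht (fun y => Rabs (y - f t x) < eps)).
    destruct hf as [delta hd].
    + exists (mkposreal _ heps); intros y hy; exact hy.
    + exists delta; split; [apply cond_pos |].
      intros t' x' ht' h1 h2; apply (hd (t', x')); [split; assumption | exact ht'].
  - intros hf [t x] ht P [eps hP].
    destruct (hf t x eps ht (cond_pos eps)) as [delta [hd h]].
    exists (mkposreal _ hd); intros [t' x'] [h1 h2] ht'.
    apply hP; apply h; assumption.
Qed.

(** Multiplying the difference quotient by [s - t] removes the division and the exclusion of
    [s = t]. The inequality becomes non-strict, hence the [eps / 2] in the converse. *)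
Lemma D_in_iff (D : R -> Prop) (y dy : R -> R) (t : R) :
  D_in y dy D t <->
  forall eps, 0 < eps -> exists delta, 0 < delta /\
    forall s, D s -> Rabs (s - t) < delta ->
      Rabs (y s - y t - dy t * (s - t)) <= eps * Rabs (s - t).
Proof.
  assert (Heq : forall s, s - t <> 0 ->
    Rabs (y s - y t - dy t * (s - t)) =
    Rabs ((y s - y t) / (s - t) - dy t) * Rabs (s - t)).
  { intros s hs; rewrite <- Rabs_mult; f_equal; field; exact hs. }
  split.
  - intros h eps heps; destruct (h eps heps) as [delta [hd h']].
    exists delta; split; [exact hd |]; intros s hs hst.
    destruct (Req_dec s t) as [-> | hne].
    + replace (y t - y t - dy t * (t - t)) with 0 by ring.
      rewrite Rminus_diag, Rabs_R0; lra.
    + rewrite Heq by lra; apply Rmult_le_compat_r; [apply Rabs_pos |].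
      apply Rlt_le, (h' s); split; [split; [exact hs | auto] | exact hst].
  - intros h eps heps; destruct (h (eps / 2)) as [delta [hd h']]; [lra |].
    exists delta; split; [exact hd |]; intros s [[hs hne] hst].
    assert (hpos : 0 < Rabs (s - t)) by (apply Rabs_pos_lt; auto with real).
    specialize (h' s hs hst); rewrite Heq in h' by auto with real.
    apply Rmult_le_reg_r in h'; [| exact hpos].
    apply Rle_lt_trans with (1 := h'); lra.
Qed.

Lemma D_in_continuous (D : R -> Prop) (y dy : R -> R) (t : R) :
  D_in y dy D t -> forall eps, 0 < eps -> exists delta, 0 < delta /\
    forall s, D s -> Rabs (s - t) < delta -> Rabs (y s - y t) < eps.
Proof.
  intros h eps heps.
  destruct (proj1 (D_in_iff D y dy t) h 1 Rlt_0_1) as [delta [hd h']].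
  pose proof (Rabs_pos (dy t)) as hp.
  (* Tolerance 1 in the derivative bounds [Rabs (y s - y t)] by
     [(1 + Rabs (dy t)) * Rabs (s - t)]. *)
  assert (hq : 0 < eps / (2 + Rabs (dy t))) by (apply Rdiv_lt_0_compat; lra).
  exists (Rmin delta (eps / (2 + Rabs (dy t)))).
  split; [apply Rmin_pos; assumption |]; intros s hs hst.
  specialize (h' s hs (Rlt_le_trans _ _ _ hst (Rmin_l _ _))).
  assert (h2 := Rlt_le_trans _ _ _ hst (Rmin_r _ _)).
  replace (y s - y t) with ((y s - y t - dy t * (s - t)) + dy t * (s - t)) by ring.
  apply Rle_lt_trans with (1 := Rabs_triang _ _); rewrite (Rabs_mult (dy t)).
  apply (Rmult_lt_compat_r (2 + Rabs (dy t))) in h2; [| lra].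
  replace (eps / (2 + Rabs (dy t)) * (2 + Rabs (dy t))) with eps in h2 by (field; lra).
  pose proof (Rabs_pos (s - t)); nra.
Qed.

(** * A one-sided differential inequality *)

Lemma nonpositive_of_derivative (t0 a : R) (w dw : R -> R) :
  has_derivative_on (I_set t0 a) w dw -> w t0 <= 0 ->
  (forall t, I_set t0 a t -> 0 < w t -> dw t <= 0) ->
  forall t, I_set t0 a t -> w t <= 0.
Proof.
  intros hder h0 hsign t1 ht1; destruct ht1 as [ht1 ht1'].
  apply le_epsilon; intros zeta hzeta; apply Rnot_lt_le; intros hgt.
  (* Compare [w] with the line [e (1 + t - t0)], which is positive and
     increasing: at the last crossing time [s], [w s > 0] forces [dw s <= 0 < e]. *)
  set (e := zeta / (1 + t1 - t0)).
  assert (he : 0 < e) by (apply Rdiv_lt_0_compat; lra).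
  assert (hez : e * (1 + t1 - t0) = zeta) by (unfold e; field; lra).
  set (v := fun t => w t - e * (1 + t - t0)).
  destruct (completeness (fun t => t0 <= t <= t1 /\ v t <= 0)) as [s [hub hlub]].
  { exists t1; intros t [[_ h] _]; exact h. }
  { exists t0; unfold v; lra. }
  assert (hs0 : t0 <= s) by (apply hub; unfold v; lra).
  assert (hs1 : s <= t1) by (apply hlub; intros t [[_ h] _]; exact h).
  assert (hsI : I_set t0 a s) by (split; lra).
  assert (hright : forall t, s < t <= t1 -> 0 < v t).
  { intros t ht; apply Rnot_le_lt; intros h.
    assert (t <= s); [apply hub; split; lra | lra]. }
  assert (hcont : forall eps, 0 < eps -> exists delta, 0 < delta /\
    forall t, I_set t0 a t -> Rabs (t - s) < delta -> Rabs (v t - v s) < eps).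
  { intros eps heps.
    destruct (D_in_continuous _ _ _ _ (hder s hsI) (eps / 2)) as [d [hd h]]; [lra |].
    assert (0 < eps / (2 * e)) by (apply Rdiv_lt_0_compat; lra).
    exists (Rmin d (eps / (2 * e))); split; [apply Rmin_pos; assumption |].
    intros t ht hts.
    specialize (h t ht (Rlt_le_trans _ _ _ hts (Rmin_l _ _))).
    assert (h2 := Rlt_le_trans _ _ _ hts (Rmin_r _ _)).
    replace (v t - v s) with ((w t - w s) + - (e * (t - s))) by (unfold v; ring).
    apply Rle_lt_trans with (1 := Rabs_triang _ _).
    rewrite Rabs_Ropp, Rabs_mult, (Rabs_pos_eq e) by lra.
    apply (Rmult_lt_compat_l e) in h2; [| lra].
    replace (e * (eps / (2 * e))) with (eps / 2) in h2 by (field; lra); lra. }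
  (* Otherwise [v] would be positive just left of [s] as well, and a smaller upper bound would
     exist. *)
  assert (hvs : v s <= 0).
  { apply Rnot_lt_le; intros hv; destruct (hcont (v s) hv) as [d [hd h]].
    assert (s <= s - d); [| lra].
    apply hlub; intros t [ht hvt].
    assert (hts : t <= s) by (apply hub; split; lra).
    apply Rnot_lt_le; intros hlt.
    assert (hv' : Rabs (v t - v s) < v s)
      by (apply h; [split; lra | apply Rabs_def1; lra]).
    apply Rabs_def2 in hv'; lra. }
  assert (hv1 : 0 < v t1) by (unfold v; lra).
  assert (hlt : s < t1)
    by (destruct hs1 as [h | ->]; [exact h | lra]).
  assert (hvs' : 0 <= v s).
  { apply Rnot_lt_le; intros hv; destruct (hcont (- v s)) as [d [hd h]]; [lra |].
    set (t := Rmin t1 (s + d / 2)).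
    assert (ht : s < t <= t1)
      by (split; [apply Rmin_glb_lt; lra | apply Rmin_l]).
    pose proof (Rmin_r t1 (s + d / 2) : t <= _).
    assert (hv' : Rabs (v t - v s) < - v s)
      by (apply h; [split; lra | apply Rabs_def1; lra]).
    apply Rabs_def2 in hv'; specialize (hright t ht); lra. }
  assert (hws : 0 < w s) by (unfold v in hvs'; nra).
  specialize (hsign s hsI hws).
  (* With [dw s <= 0], tolerance [e / 2] gives [w t - w s <= e / 2 * (t - s)] just right of [s],
     while [v s <= 0 < v t] forces more than [e * (t - s)]. *)
  destruct (proj1 (D_in_iff _ _ _ _) (hder s hsI) (e / 2)) as [d [hd h]]; [lra |].
  set (t := Rmin t1 (s + d / 2)).
  assert (ht : s < t <= t1)
    by (split; [apply Rmin_glb_lt; lra | apply Rmin_l]).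
  pose proof (Rmin_r t1 (s + d / 2) : t <= _).
  assert (htI : I_set t0 a t) by (split; lra).
  specialize (h t htI); rewrite (Rabs_pos_eq (t - s)) in h by lra.
  specialize (h ltac:(lra)); specialize (hright t ht); unfold v in *.
  pose proof (Rle_abs (w t - w s - dw s * (t - s))); nra.
Qed.

(** * Euler's method *)

Fixpoint euler (F : R -> R -> R) (t0 y0 h : R) (n : nat) : R :=
  match n with
  | O => y0
  | S k => euler F t0 y0 h k + h * F (t0 + INR k * h) (euler F t0 y0 h k)
  end.

(** The increment telescopes, and each step deviates from [h * c] by at most [h * eps]. The choice
    [c = 0] gives the Lipschitz bound, [c = F t (phi t)] the derivative of the limit. *)
Lemma euler_increment (F : R -> R -> R) (t0 y0 h c eps : R) (j k : nat) :
  0 <= h -> (j <= k)%nat ->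
  (forall i, (j <= i < k)%nat ->
     Rabs (F (t0 + INR i * h) (euler F t0 y0 h i) - c) <= eps) ->
  Rabs (euler F t0 y0 h k - euler F t0 y0 h j - (INR k - INR j) * h * c)
    <= (INR k - INR j) * h * eps.
Proof.
  intros hh hjk; induction hjk as [| k hjk IH]; intros hi.
  - match goal with |- Rabs ?x <= _ => replace x with 0 by ring end.
    rewrite Rabs_R0; lra.
  - specialize (IH (fun i hik => hi i ltac:(lia))).
    specialize (hi k ltac:(lia)).
    rewrite S_INR; simpl euler.
    match goal with |- Rabs ?x <= _ => replace x with
      ((euler F t0 y0 h k - euler F t0 y0 h j - (INR k - INR j) * h * c) +
       h * (F (t0 + INR k * h) (euler F t0 y0 h k) - c)) by ring end.
    apply Rle_trans with (1 := Rabs_triang _ _).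
    rewrite Rabs_mult, (Rabs_pos_eq h hh).
    apply (Rmult_le_compat_l h) in hi; [| exact hh]; lra.
Qed.

(** Bounding by the whole window from [j] to [k] makes the order of [i] and [l] irrelevant. The
    condition [INR k * h <= a] keeps the nodes in the interval, where [M] bounds [F]. *)
Lemma euler_lipschitz (F : R -> R -> R) (t0 y0 a h M : R) (i j k l : nat) :
  (forall t x, I_set t0 a t -> Rabs (F t x) <= M) ->
  0 <= h -> (j <= i <= k)%nat -> (j <= l <= k)%nat -> INR k * h <= a ->
  Rabs (euler F t0 y0 h i - euler F t0 y0 h l) <= M * ((INR k - INR j) * h).
Proof.
  intros hM hh.
  assert (hord : forall p q, (j <= p <= q)%nat -> (q <= k)%nat -> INR k * h <= a ->
    Rabs (euler F t0 y0 h q - euler F t0 y0 h p) <= M * ((INR k - INR j) * h)).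
  { intros p q hpq hqk hk.
    assert (hnode : forall m, (m <= k)%nat -> I_set t0 a (t0 + INR m * h)).
    { intros m hm; apply le_INR in hm; pose proof (pos_INR m); split; nra. }
    assert (hM0 : 0 <= M).
    { apply Rle_trans with (2 := hM _ 0 (hnode O ltac:(lia))); apply Rabs_pos. }
    assert (h1 := euler_increment F t0 y0 h 0 M p q hh ltac:(lia)).
    rewrite Rmult_0_r, Rminus_0_r in h1.
    apply Rle_trans with ((INR q - INR p) * h * M).
    - apply h1; intros m hm; rewrite Rminus_0_r; apply hM, hnode; lia.
    - rewrite Rmult_comm; apply Rmult_le_compat_l; [exact hM0 |].
      apply Rmult_le_compat_r; [exact hh |].
      destruct hpq as [hp _]; apply le_INR in hp; apply le_INR in hqk; lra. }
  intros hi hl hk; destruct (Nat.le_ge_cases l i).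
  - apply hord; lia || exact hk.
  - rewrite Rabs_minus_sym; apply hord; lia || exact hk.
Qed.

(** * Peano existence for a bounded right-hand side *)

Lemma peano_bounded (t0 y0 a M : R) (F : R -> R -> R) :
  0 <= a -> continuous_on_strip t0 a F ->
  (forall t x, I_set t0 a t -> Rabs (F t x) <= M) ->
  exists phi, solution F t0 y0 a phi.
Proof.
  intros ha hF hM.
  assert (hM0 : 0 <= M).
  { apply Rle_trans with (2 := hM t0 0 ltac:(split; lra)); apply Rabs_pos. }
  (* [N] is the floor function on nonnegative reals, with default 0 elsewhere; [k n t] below is then
     the index of the last node not after [t]. *)
  destruct (choice (fun r (n : nat) => 0 <= r -> INR n <= r < INR n + 1)) as [N hN].
  { intros r; destruct (Rle_dec 0 r) as [h | h].
    - destruct (nfloor_ex r h) as [n hn]; exists n; intros _; exact hn.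
    - exists O; intros h'; contradiction. }
  set (h := fun n => / (INR n + 1)).
  assert (hh : forall n, 0 < h n)
    by (intros n; apply Rinv_0_lt_compat, INRp1_pos).
  set (k := fun n t => N ((t - t0) / h n)).
  assert (hk : forall n t, t0 <= t ->
    INR (k n t) * h n <= t - t0 < INR (k n t) * h n + h n).
  { intros n t ht; specialize (hh n).
    assert (hr : 0 <= (t - t0) / h n) by (apply Rdiv_le_0_compat; lra).
    destruct (hN _ hr) as [h1 h2]; fold (k n t) in h1, h2.
    replace (t - t0) with ((t - t0) / h n * h n) by (field; lra); nra. }
  assert (hmono : forall n s t, t0 <= s -> s <= t -> (k n s <= k n t)%nat).
  { intros n s t h1 h2; specialize (hh n).
    pose proof (hk n s h1); pose proof (hk n t ltac:(lra)).
    assert (hlt : INR (k n s) < INR (S (k n t))) by (rewrite S_INR; nra).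
    apply INR_lt in hlt; lia. }
  set (u := fun n t => euler F t0 y0 (h n) (k n t)).
  assert (hu0 : forall n t, I_set t0 a t -> Rabs (u n t - y0) <= M * (t - t0)).
  { intros n t [h1 h2]; specialize (hh n); pose proof (hk n t h1) as hkt.
    apply Rle_trans with (M * ((INR (k n t) - INR 0) * h n)).
    - apply (euler_lipschitz F t0 y0 a (h n) M (k n t) 0 (k n t) 0 hM);
        lia || lra.
    - apply Rmult_le_compat_l; [exact hM0 |]; simpl; lra. }
  destruct (pointwise_cluster_point R u) as [phi hphi].
  (* A single [n] with small mesh must approximate at three times at once: the point [t] and the
     ends of a window around it. *)
  assert (happrox : forall t1 t t2 eta,
    I_set t0 a t1 -> I_set t0 a t -> I_set t0 a t2 -> 0 < eta ->
    exists n, h n < eta /\ Rabs (u n t1 - phi t1) < eta /\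
      Rabs (u n t - phi t) < eta /\ Rabs (u n t2 - phi t2) < eta).
  { intros t1 t t2 eta i1 i i2 heta.
    destruct (INR_unbounded (/ eta)) as [m hm].
    destruct (hphi eta m (t1 :: t :: t2 :: nil) heta) as [n [hn hxs]].
    - intros x hx.
      assert (hxI : I_set t0 a x)
        by (destruct hx as [<- | [<- | [<- | []]]]; assumption).
      exists (Rabs y0 + M * (x - t0)); intros n.
      replace (u n x) with (y0 + (u n x - y0)) by ring.
      apply Rle_trans with (1 := Rabs_triang _ _); specialize (hu0 n x hxI); lra.
    - exists n; repeat split; try (apply hxs; simpl; auto).
      apply le_INR in hn; unfold h; rewrite <- (Rinv_inv eta).
      pose proof (Rinv_0_lt_compat eta heta).
      apply Rinv_lt_contravar; [apply Rmult_lt_0_compat |]; lra. }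
  exists phi; split.
  - apply cond_eq; intros eta heta.
    assert (i0 : I_set t0 a t0) by (split; lra).
    destruct (happrox t0 t0 t0 eta i0 i0 i0 heta) as [n [_ [hn _]]].
    specialize (hu0 n t0 i0); rewrite Rminus_diag, Rmult_0_r in hu0.
    apply Rabs_def2 in hn; apply Rabs_le_between in hu0.
    apply Rabs_def1; lra.
  - assert (hkey : forall t eps, I_set t0 a t -> 0 < eps -> exists delta, 0 < delta /\
      forall t1 t2, I_set t0 a t1 -> I_set t0 a t2 -> t1 <= t <= t2 -> t2 - t1 < delta ->
        Rabs (phi t2 - phi t1 - (t2 - t1) * F t (phi t)) <= eps * (t2 - t1)).
    { intros t eps it heps.
      destruct (proj1 (continuous_on_strip_iff _ _ _) hF t (phi t) eps it heps)
        as [d [hd hcont]].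
      (* On a window shorter than this, neither the time nor a function with slope at most [M] moves
         by [d], and the slack [hgap] remains for the mesh and limit errors. *)
      exists (d / (M + 1)); split; [apply Rdiv_lt_0_compat; lra |].
      intros t1 t2 i1 i2 [h1 h2] hclose.
      assert (hgap : 0 < d - (M + 1) * (t2 - t1)).
      { apply (Rmult_lt_compat_l (M + 1)) in hclose; [| lra].
        replace ((M + 1) * (d / (M + 1))) with d in hclose by (field; lra); lra. }
      apply le_epsilon; intros zeta hzeta.
      (* The first bound absorbs the final errors: [2 * eta] from replacing [u n] by [phi] at both
         ends, [eta * eps] and [eta * M] from the window length being off by less than a mesh. The
         second keeps all Euler nodes and values of the window within [d] of [t] and [phi t]. *)
      set (eta := Rmin (zeta / (2 + eps + M)) ((d - (M + 1) * (t2 - t1)) / (M + 2))).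
      assert (heta : 0 < eta) by (apply Rmin_pos; apply Rdiv_lt_0_compat; lra).
      assert (heta1 : eta * (2 + eps + M) <= zeta).
      { replace zeta with (zeta / (2 + eps + M) * (2 + eps + M)) by (field; lra).
        apply Rmult_le_compat_r; [lra | apply Rmin_l]. }
      assert (heta2 : eta * (M + 2) <= d - (M + 1) * (t2 - t1)).
      { replace (d - (M + 1) * (t2 - t1))
          with ((d - (M + 1) * (t2 - t1)) / (M + 2) * (M + 2)) at 1 by (field; lra).
        apply Rmult_le_compat_r; [lra | apply Rmin_r]. }
      destruct (happrox t1 t t2 eta i1 it i2 heta) as [n [hn [a1 [a2 a3]]]].
      destruct i1 as [i1 i1'], i2 as [i2 i2'].
      specialize (hh n).
      pose proof (hk n t1 i1) as k1; pose proof (hk n t2 i2) as k2.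
      pose proof (hk n t ltac:(lra)) as k0.
      pose proof (hmono n t1 t i1 h1) as m1.
      pose proof (hmono n t t2 ltac:(lra) h2) as m2.
      set (c := F t (phi t)).
      assert (hinc : Rabs (u n t2 - u n t1 - (INR (k n t2) - INR (k n t1)) * h n * c)
                     <= (INR (k n t2) - INR (k n t1)) * h n * eps).
      { apply euler_increment; [lra | lia |]; intros i hi.
        assert (hi1 : INR (k n t1) <= INR i) by (apply le_INR; lia).
        assert (hi2 : INR i + 1 <= INR (k n t2))
          by (rewrite <- S_INR; apply le_INR; lia).
        apply (Rmult_le_compat_r (h n)) in hi1; [| lra].
        apply (Rmult_le_compat_r (h n)) in hi2; [| lra].
        pose proof (pos_INR (k n t1)).
        apply Rlt_le, hcont.
        - split; nra.
        - apply Rabs_def1; nra.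
        - replace (euler F t0 y0 (h n) i - phi t)
            with ((euler F t0 y0 (h n) i - u n t) + (u n t - phi t)) by ring.
          apply Rle_lt_trans with (1 := Rabs_triang _ _).
          (* By monotonicity of [k n], the window contains both [i] and the index of [t]. *)
          assert (hlip : Rabs (euler F t0 y0 (h n) i - u n t)
                    <= M * ((INR (k n t2) - INR (k n t1)) * h n))
            by (apply (euler_lipschitz F t0 y0 a (h n) M _ _ _ _ hM); lia || lra).
          assert (M * ((INR (k n t2) - INR (k n t1)) * h n) <= M * (t2 - t1 + h n))
            by (apply Rmult_le_compat_l; lra).
          nra. }
      assert (hc : Rabs c <= M) by (apply hM; exact it).
      set (q := (INR (k n t2) - INR (k n t1)) * h n) in *.
      replace (phi t2 - phi t1 - (t2 - t1) * c) with
        ((u n t2 - u n t1 - q * c) + (- (u n t2 - phi t2) + (u n t1 - phi t1)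
         + (q - (t2 - t1)) * c)) by ring.
      assert (hq : Rabs ((q - (t2 - t1)) * c) <= eta * M).
      { rewrite Rabs_mult; apply Rmult_le_compat; try apply Rabs_pos; [| exact hc].
        apply Rabs_le; unfold q; lra. }
      assert (hqe : q * eps <= (t2 - t1 + eta) * eps)
        by (apply Rmult_le_compat_r; unfold q; lra).
      apply Rabs_def2 in a1; apply Rabs_def2 in a3.
      apply Rabs_le_between in hinc; apply Rabs_le_between in hq.
      apply Rabs_le; lra. }
    intros t it; apply D_in_iff; intros eps heps.
    destruct (hkey t eps it heps) as [d [hd hb]].
    exists d; split; [exact hd |]; intros s is hst.
    apply Rabs_def2 in hst.
    (* The window runs between [t] and [s], with [t] as its left or right end. *)
    destruct (Rle_dec t s) as [hts | hts].
    + rewrite (Rabs_pos_eq (s - t)) by lra.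
      rewrite (Rmult_comm (F t (phi t))); apply hb; auto; lra.
    + rewrite (Rabs_minus_sym s t), (Rabs_pos_eq (t - s)) by lra.
      rewrite <- Rabs_Ropp.
      match goal with |- Rabs ?x <= _ =>
        replace x with (phi t - phi s - (t - s) * F t (phi t)) by ring end.
      apply hb; auto; lra.
Qed.

(** * Truncation and comparison with [alpha] and [beta] *)

Theorem theorem4p1 (t0 y0 a : R) (ha : 0 < a) (f : R -> R -> R)
  (hf : continuous_on_strip t0 a f)
  (alpha beta : R -> R)
  (halpha : lower_solution f t0 y0 a alpha)
  (hbeta : upper_solution f t0 y0 a beta)
  (hle : forall t, I_set t0 a t -> alpha t <= beta t) :
  exists phi : R -> R,
    solution f t0 y0 a phi /\
    (forall t, I_set t0 a t -> alpha t <= phi t <= beta t).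
Proof.
  destruct halpha as [dalpha [hda [_ [ha0 hla]]]].
  destruct hbeta as [dbeta [hdb [_ [hb0 hub]]]].
  assert (hbound : forall y dy, has_derivative_on (I_set t0 a) y dy ->
    exists K, forall t, I_set t0 a t -> Rabs (y t) <= K).
  { intros y dy hd.
    (* A degenerate rectangle reduces the one-variable bound to the two-variable lemma. *)
    destruct (bounded_on_rectangle t0 (t0 + a) 0 0 (fun t _ => y t)) as [K hK].
    - intros t x ht _.
      destruct (D_in_continuous _ _ _ _ (hd t ht) 1 Rlt_0_1) as [d [hd0 h]].
      exists d, (Rabs (y t) + 1); split; [exact hd0 |].
      intros t' x' ht' _ htt _; specialize (h t' ht' htt).
      pose proof (Rabs_triang_inv (y t') (y t)); lra.
    - exists K; intros t ht; apply (hK t 0 ht); lra. }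
  destruct (hbound _ _ hda) as [A hA]; destruct (hbound _ _ hdb) as [B hB].
  set (clip := fun t x => Rmax (alpha t) (Rmin (beta t) x)).
  assert (hclip : forall t x, I_set t0 a t -> - (A + B) <= clip t x <= A + B).
  { intros t x ht; specialize (hA t ht); specialize (hB t ht); specialize (hle t ht).
    pose proof (Rabs_pos (alpha t)); pose proof (Rabs_pos (beta t)).
    apply Rabs_le_between in hA; apply Rabs_le_between in hB.
    unfold clip, Rmax, Rmin; destruct (Rle_dec (beta t) x);
      destruct (Rle_dec (alpha t) _); lra. }
  destruct (bounded_on_rectangle t0 (t0 + a) (- (A + B)) (A + B) f) as [M hM].
  { intros t x ht _.
    destruct (proj1 (continuous_on_strip_iff _ _ _) hf t x 1 ht Rlt_0_1)
      as [d [hd h]].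
    exists d, (Rabs (f t x) + 1); split; [exact hd |].
    intros t' x' ht' _ h1 h2; specialize (h t' x' ht' h1 h2).
    pose proof (Rabs_triang_inv (f t' x') (f t x)); lra. }
  set (F := fun t x => f t (clip t x)).
  destruct (peano_bounded t0 y0 a M F) as [phi [hphi0 hphi]].
  - lra.
  - apply continuous_on_strip_iff; intros t x eps ht heps.
    destruct (proj1 (continuous_on_strip_iff _ _ _) hf t (clip t x) eps ht heps)
      as [d [hd h]].
    (* Maxima and minima are nonexpansive: if [alpha], [beta] and [x] each move by less than [d], so
       does [clip]. *)
    destruct (D_in_continuous _ _ _ _ (hda t ht) d hd) as [d1 [hd1 h1]].
    destruct (D_in_continuous _ _ _ _ (hdb t ht) d hd) as [d2 [hd2 h2]].
    exists (Rmin d (Rmin d1 d2)).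
    split; [repeat apply Rmin_pos; assumption |].
    intros t' x' ht' htt hxx.
    assert (e0 := Rmin_l d (Rmin d1 d2)); assert (e := Rmin_r d (Rmin d1 d2)).
    assert (e1 := Rmin_l d1 d2); assert (e2 := Rmin_r d1 d2).
    apply h; [exact ht' | lra |].
    specialize (h1 t' ht' ltac:(lra)); specialize (h2 t' ht' ltac:(lra)).
    apply Rlt_le_trans with (2 := e0) in hxx.
    apply Rabs_def2 in h1; apply Rabs_def2 in h2; apply Rabs_def2 in hxx.
    unfold clip, Rmax, Rmin;
      destruct (Rle_dec (beta t) x); destruct (Rle_dec (beta t') x');
      destruct (Rle_dec (alpha t) _); destruct (Rle_dec (alpha t') _);
      apply Rabs_def1; lra.
  - intros t x ht; apply hM; [exact ht | apply hclip; exact ht].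
  - assert (hup : forall t, I_set t0 a t -> phi t - beta t <= 0).
    { apply (nonpositive_of_derivative t0 a (fun t => phi t - beta t)
               (fun t => F t (phi t) - dbeta t)); [| lra |].
      - intros t ht; apply Dminus; [apply hphi | apply hdb]; exact ht.
      - intros t ht hpos; specialize (hub t ht); specialize (hle t ht).
        unfold F, clip; rewrite Rmin_left, Rmax_right by lra; lra. }
    assert (hlo : forall t, I_set t0 a t -> alpha t - phi t <= 0).
    { apply (nonpositive_of_derivative t0 a (fun t => alpha t - phi t)
               (fun t => dalpha t - F t (phi t))); [| lra |].
      - intros t ht; apply Dminus; [apply hda | apply hphi]; exact ht.
      - intros t ht hpos; specialize (hla t ht); specialize (hle t ht).
        unfold F, clip; rewrite Rmin_right, Rmax_left by lra; lra. }
    assert (hin : forall t, I_set t0 a t -> alpha t <= phi t <= beta t).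
    { intros t ht; specialize (hup t ht); specialize (hlo t ht); lra. }
    exists phi; split; [split; [exact hphi0 |] | exact hin].
    intros t ht; specialize (hphi t ht); specialize (hin t ht).
    (* Unfolded, the derivative enters only through its value at [t], so agreement of [F] and [f] at
       this one point suffices. *)
    unfold D_in in *.
    replace (f t (phi t)) with (F t (phi t)); [exact hphi |].
    unfold F, clip; rewrite Rmin_right, Rmax_right by lra; reflexivity.
Qed.
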